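(* Let $p$ be a prime, let $n\ge 1$ be an integer, and let $C_p^n=C_p\times\cdots\times C_p$ ($n$ factors). Then $$\mathcal{V}(C_p^n)=\frac{\binom{n}{1}_p}{\sum_{k=0}^{n}\binom{n}{k}_p},$$ where $\binom{n}{k}_p=\prod_{i=1}^{k}\frac{p^n-p^{i-1}}{p^k-p^{i-1}}$ and $\binom{n}{1}_p=\frac{p^n-1}{p-1}$.
   Context: For a finite group $G$, $L(G)$ denotes the set of all subgroups of $G$ (including the trivial subgroup and $G$ itself), $s(G)$ denotes the number of subgroups of $G$ that are simple groups (the trivial group is not simple; cyclic groups of prime order are simple), and $\mathcal{V}(G)=s(G)/|L(G)|$. Subgroups are counted as subsets of $G$. $C_p$ is the cyclic group of order $p$; the empty product (case $k=0$) equals $1$. *)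

(* Defs.v *)
From mathcomp Require Import all_boot all_order all_algebra.
From mathcomp Require Import all_fingroup all_solvable.

Set Implicit Arguments.
Unset Strict Implicit.
Unset Printing Implicit Defensive.

Import GRing.Theory Num.Theory.

Local Open Scope ring_scope.

(* [simple H] is minimality of H among its nontrivial normal subgroups, so the
   trivial group is not simple. *)
Definition simple_subgroups (gT : finGroupType) (G : {group gT}) :
    {set {group gT}} :=
  [set H in subgroups G | simple H].

Definition simple_ratio (gT : finGroupType) (G : {group gT}) : rat :=
  #|simple_subgroups G|%:R / #|subgroups G|%:R.

Definition cyclic_power (p n : nat) : {group {dffun 'I_n -> 'Z_p}} :=
  setXn_group (fun _ : 'I_n => Zp_group p).

(* The exponent [i.-1] is the usual i - 1, since i starts at 1. *)
Definition gauss_binomial (q n k : nat) : rat :=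
  \prod_(1 <= i < k.+1)
    ((q%:R ^+ n - q%:R ^+ i.-1) / (q%:R ^+ k - q%:R ^+ i.-1)).

(* Main.v *)
Require Import Defs.
From mathcomp Require Import all_boot all_order all_algebra.
From mathcomp Require Import all_fingroup all_solvable.

(* In an elementary abelian group E of order p^n, sort the pairs (H, x), with H
   a subgroup of order p^k and x in E \ H, according to the subgroup
   K = <H, x>, which has order p^(k+1).  Writing N_k(E) for the number of
   subgroups of order p^k, this gives
     N_k(E) (p^n - p^k) = N_(k+1)(E) N_k(C_p^(k+1)) (p^(k+1) - p^k),
   which determines N_k(E) by induction on k.  The simple subgroups of E are
   those of order p. *)

Import GRing.Theory Num.Theory.

Local Open Scope group_scope.
Local Open Scope ring_scope.

(** Since x lies outside H, it is nontrivial and so of order p; then <x> meets H trivially. As E is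
    abelian, the join is the product of H and <x>, of order p^k p. *)
Lemma join_cycle_pnElem (gT : finGroupType) (p k : nat) (E H : {group gT})
    (x : gT) :
    prime p -> p.-abelem E -> H \in 'E_p^k(E) -> x \in E :\: H ->
  (H <*> <[x]>)%G \in 'E_p^k.+1(E).
Proof.
move=> p_pr abE /pnElemP[sHE abH logH] /setDP[Ex notHx].
have p_x : #[x] = p.
  by apply: (abelem_order_p abE Ex); apply: contraNneq notHx => ->.
have sxE : <[x]> \subset E by rewrite cycle_subG.
have sKE : H <*> <[x]> \subset E by rewrite join_subG sHE.
rewrite pnElemE // !inE sKE (abelemS sKE abE) /=.
have cHx : <[x]> \subset 'C(H).
  exact: subset_trans sxE (subset_trans (abelem_abelian abE) (centS sHE)).
rewrite cent_joinEr // TI_cardMg; last first.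
  by rewrite setIC prime_TIg -?orderE ?p_x // cycle_subG.
by rewrite -orderE p_x (card_pgroup (abelem_pgroup abH)) logH expnSr.
Qed.

Lemma sum_setD_pnElem (gT : finGroupType) (p k : nat) (E : {group gT}) :
    prime p -> p.-abelem E ->
  (\sum_(H in 'E_p^k(E)) #|E :\: H| =
     \sum_(K in 'E_p^k.+1(E)) \sum_(H in 'E_p^k(K)) #|K :\: H|)%N.
Proof.
move=> p_pr abE.
transitivity (\sum_(H in 'E_p^k(E)) \sum_(K in 'E_p^k.+1(E))
    \sum_(x in E :\: H | (H <*> <[x]>)%G == K) 1)%N.
  apply: eq_bigr => H EH; rewrite -sum1_card.
  by apply: partition_big => x; apply: join_cycle_pnElem.
rewrite exchange_big; apply: eq_bigr => K EK.
have [sKE abK _] := pnElemP EK; have oK := card_pnElem EK.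
(* With K fixed, an H outside K contributes nothing, because H is contained in <H, x>. *)
rewrite (bigID (fun H : {group gT} => H \subset K)) /= addnC big1 => [|H].
  rewrite add0n; apply: eq_big => [H | H /andP[EH sHK]].
    apply/andP/idP => [[/pnElemP[_ abH logH] sHK] | /pnElemP[sHK abH logH]].
      exact/pnElemP.
    by split=> //; apply/pnElemP; rewrite (subset_trans sHK).
  rewrite sum1_card; apply: eq_card => x; rewrite unfold_in /= !inE.
  have [//|notHx /=] := boolP (x \in H).
  apply/andP/idP => [[_ /eqP <-] | Kx].
    by rewrite (subsetP (joing_subr _ _)) ?cycle_id.
  have Ex := subsetP sKE x Kx; split=> //.
  (* Every x in K \ H qualifies: <H, x> lies in K and both have order p^(k+1). *)
  rewrite -val_eqE /= eqEcard join_subG sHK cycle_subG Kx /= oK.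
  have /card_pnElem /= -> // : (H <*> <[x]>)%G \in 'E_p^k.+1(E).
  by apply: join_cycle_pnElem; rewrite // inE notHx.
case/andP=> _ nsHK; rewrite big1 // => x /andP[_ /eqP defK].
by rewrite -defK joing_subl in nsHK.
Qed.

(** The induction on k keeps n and E general: its hypothesis serves once for E itself and once for
    each subgroup K of order p^(k+1), with k+1 in place of n. When k > n both sides are 0, by the
    factor i = n on the right. *)
Lemma card_pnElem_abelem (gT : finGroupType) (p k n : nat) (E : {group gT}) :
    prime p -> p.-abelem E -> #|E| = (p ^ n)%N ->
  #|'E_p^k(E)|%:R * \prod_(i < k) (p%:R ^+ k - p%:R ^+ i)
    = \prod_(i < k) (p%:R ^+ n - p%:R ^+ i) :> rat.
Proof.
move=> p_pr; elim: k n E => [|k IHk] n E abE oE.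
  by rewrite !big_ord0 pnElem0 cards1 mulr1.
have cardD m (K : {group gT}) : #|K| = (p ^ m)%N ->
    (\sum_(H in 'E_p^k(K)) #|K :\: H|)%:R
      = #|'E_p^k(K)|%:R * (p%:R ^+ m - p%:R ^+ k) :> rat.
  move=> oK; rewrite natr_sum mulr_natl -sumr_const.
  apply: eq_bigr => H EH; have [sHK _ _] := pnElemP EH.
  rewrite cardsD (setIidPr sHK) natrB ?subset_leq_card //.
  by rewrite oK (card_pnElem EH) !natrX.
rewrite !big_ord_recr /= -(IHk n E abE oE) mulrAC -cardD //.
rewrite (sum_setD_pnElem _ p) // natr_sum mulr_suml mulr_natl -sumr_const.
apply: eq_bigr => K EK; have [_ abK _] := pnElemP EK.
have oK := card_pnElem EK.
by rewrite (cardD k.+1) // mulrAC (IHk k.+1).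
Qed.

Lemma gauss_binomialE (q n k : nat) :
  gauss_binomial q n k =
    \prod_(i < k) (q%:R ^+ n - q%:R ^+ i)
      / \prod_(i < k) (q%:R ^+ k - q%:R ^+ i).
Proof. by rewrite /gauss_binomial big_add1 big_mkord prodf_div. Qed.

Lemma card_pnElem_gauss (gT : finGroupType) (p k n : nat) (E : {group gT}) :
    prime p -> p.-abelem E -> #|E| = (p ^ n)%N ->
  #|'E_p^k(E)|%:R = gauss_binomial p n k.
Proof.
move=> p_pr abE oE; rewrite gauss_binomialE.
rewrite -(card_pnElem_abelem _ p k n E) // mulfK //.
(* The denominator is nonzero: p^i differs from p^k for i < k, as p > 1. *)
apply/prodf_neq0 => i _; rewrite subr_eq0 -!natrX eqr_nat.
by rewrite eqn_exp2l ?prime_gt1 // gtn_eqF.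
Qed.

Lemma card_subgroups_abelem (gT : finGroupType) (p n : nat) (E : {group gT}) :
    prime p -> p.-abelem E -> #|E| = (p ^ n)%N ->
  #|subgroups E| = (\sum_(k < n.+1) #|'E_p^k(E)|)%N.
Proof.
move=> p_pr abE oE; rewrite -sum1_card.
have log_le (H : {group gT}) : H \in subgroups E -> (logn p #|H| < n.+1)%N.
  rewrite inE ltnS => sHE; rewrite -(pfactorK n p_pr) -oE.
  by rewrite dvdn_leq_log ?cardG_gt0 ?cardSg.
(* By [log_le], [inord] never falls back on its default value 0 for a subgroup of E. *)
pose rk (H : {group gT}) : 'I_n.+1 := inord (logn p #|H|).
rewrite (partition_big rk predT) //=.
apply: eq_bigr => k _; rewrite sum1_card; apply: eq_card => H.
rewrite unfold_in /=; apply/andP/pnElemP => [[EH]|[sHE _ logH]].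
  rewrite -val_eqE /= inordK ?log_le // => /eqP logH.
  by rewrite inE in EH; split=> //; apply: abelemS abE.
have EH : H \in subgroups E by rewrite inE.
by split; rewrite // -val_eqE /= inordK ?log_le ?logH.
Qed.

Lemma prime_card_simple (gT : finGroupType) (G : {group gT}) :
  prime #|G| -> simple G.
Proof.
move=> oG; apply/simpleP; split=> [|H /andP[sHG _]].
  by rewrite -cardG_gt1 prime_gt1.
have /primeP[_ /(_ _ (cardSg sHG))] := oG.
case/orP=> /eqP oH; first by left; apply: card1_trivg.
by right; apply/eqP; rewrite eqEcard sHG oH leqnn.
Qed.

Lemma simple_subgroups_abelem (gT : finGroupType) (p : nat) (E : {group gT}) :
  prime p -> p.-abelem E -> simple_subgroups E = 'E_p^1(E).
Proof.
move=> p_pr abE; rewrite p1ElemE //; apply/setP=> H; rewrite !inE.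
apply: andb_id2l => sHE; apply/idP/eqP => [simH | oH]; last first.
  by apply: prime_card_simple; rewrite oH.
have abH := abelemS sHE abE.
have solH := abelian_sol (abelem_abelian abH).
(* A solvable simple group has prime order, hence is cyclic; a nontrivial cyclic group that is
   p-elementary abelian has order p. *)
apply: cyclic_abelem_prime abH (prime_cyclic _) _; first exact: simple_sol_prime.
by case/simpleP: simH.
Qed.

Lemma cyclic_power_abelem (p n : nat) :
  prime p -> p.-abelem (cyclic_power p n).
Proof.
move=> p_pr; apply/abelemP=> //; split=> [|x _].
  apply/centsP=> x _ y _; apply/ffunP=> i; rewrite !ffunE.
  exact: FinRing.zmod_mulgC.
have xX m : (x ^+ m)%g = [ffun i => (x i ^+ m)%g].
  elim: m => [|m IHm]; apply/ffunP => i; first by rewrite !ffunE.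
  by rewrite expgS IHm !ffunE expgS.
(* The group law of ['Z_p] is addition, so the p-th power of a coordinate is its p-fold multiple,
   zero modulo p. *)
rewrite xX; apply/ffunP=> i; rewrite !ffunE FinRing.zmodXgE.
by rewrite -mulr_natr pchar_Zp ?mulr0 ?prime_gt1.
Qed.

Lemma card_cyclic_power (p n : nat) :
  prime p -> #|cyclic_power p n| = (p ^ n)%N.
Proof.
move=> p_pr; rewrite cardsXn prod_nat_const card_ord.
by rewrite card_Zp ?prime_gt0.
Qed.

Theorem proposition2p7 (p n : nat) (p_prime : prime p) (n_ge1 : (1 <= n)%N) :
  simple_ratio (cyclic_power p n) =
    gauss_binomial p n 1 / \sum_(0 <= k < n.+1) gauss_binomial p n k
  /\ gauss_binomial p n 1 = (p%:R ^+ n - 1) / (p%:R - 1).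
Proof.
have abG := cyclic_power_abelem p n p_prime.
have oG := card_cyclic_power p n p_prime.
split; last by rewrite gauss_binomialE !big_ord1 expr1.
rewrite /simple_ratio (simple_subgroups_abelem _ p) //.
rewrite (card_subgroups_abelem _ p n) // natr_sum big_mkord.
rewrite (card_pnElem_gauss _ p 1 n) //; congr (_ / _).
by apply: eq_bigr => k _; apply: card_pnElem_gauss.
Qed.
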